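(* Let $n_1,n_2\ge 2$ and $m_1m_2\ge 2$. Let $A=(a_{ij})$ be an $n_1\times m_1$ matrix with entries $\pm1$, $B=(b_{ij})$ an $n_2\times m_2$ Latin hypercube, $C=(c_{ij})$ an $n_1\times m_1$ Latin hypercube, $D=(d_{ij})$ an $n_2\times m_2$ matrix with entries $\pm1$, and $\gamma=n_2$. Suppose at least one of the following two conditions is true: (a) for any column index $i$, if row indices $p$ and $p'$ are such that $c_{pi}=-c_{p'i}$, then $a_{pi}=a_{p'i}$; (b) for any column index $j$, if row indices $q$ and $q'$ are such that $b_{qj}=-b_{q'j}$, then $d_{qj}=d_{q'j}$ (so that $L=A\otimes B+\gamma\,C\otimes D$ is a Latin hypercube with $n=n_1n_2$ runs and $m_1m_2$ factors). In addition, assume that $A$ and $D$ are orthogonal and that at least one of $A^TC=0$ and $B^TD=0$ holds. Then: (i) $\rho^2(L)=w_1\rho^2(B)+w_2\rho^2(C)$; (ii) $\rho_M(L)=\max\{w_3\rho_M(B),\,w_4\rho_M(C)\}$, where $$w_1=\frac{(m_2-1)(n_2^2-1)^2}{(m_1m_2-1)(n^2-1)^2},\quad w_2=\frac{n_2^4(m_1-1)(n_1^2-1)^2}{(m_1m_2-1)(n^2-1)^2},\quad w_3=\frac{n_2^2-1}{n^2-1},\quad w_4=\frac{n_2^2(n_1^2-1)}{n^2-1}.$$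
   Context: A Latin hypercube of $n\ge 2$ runs with $m$ factors is an $n\times m$ matrix each of whose columns is a permutation of the $n$ levels $-(n-1)/2,-(n-3)/2,\ldots,(n-3)/2,(n-1)/2$. A matrix $X=(x_1,\ldots,x_m)$ with columns $x_i$ is called orthogonal if $x_i^Tx_j=0$ for all $i\ne j$ (it need not be square). $\otimes$ is the Kronecker product: $A\otimes B$ is the block matrix whose $(i,j)$ block is $a_{ij}B$. For a design $X=(x_1,\ldots,x_m)$ with columns $x_j$, define $\rho_{ij}(X)=x_i^Tx_j/[x_i^Tx_i\,x_j^Tx_j]^{1/2}$, the maximum correlation $\rho_M(X)=\max_{i<j}|\rho_{ij}(X)|$, and the average squared correlation $\rho^2(X)=\sum_{i<j}\rho_{ij}^2(X)/[m(m-1)/2]$. If $X$ has only one column, $\rho_M(X)=\rho^2(X)=0$ by convention. *)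

(* Defs.v *)
From mathcomp Require Import all_boot all_order all_algebra all_fingroup.
From mathcomp Require Export mxtens.

Set Implicit Arguments.
Unset Strict Implicit.
Unset Printing Implicit Defensive.

Import Order.TTheory GRing.Theory Num.Theory.
Local Open Scope ring_scope.

(* With 0-based indices, the (i * p + k, j * q + l) entry of tensmx A B,
   B : 'M_(p, q), is A i j * B k l, so its (i, j) block is A i j *: B. *)
Notation "A *t B" := (tensmx A B)
  (at level 40, left associativity, format "A  *t  B") : ring_scope.

Section Designs.

Variable R : rcfType.

(* For k = 0, ..., n - 1: -(n-1)/2, -(n-3)/2, ..., (n-3)/2, (n-1)/2. *)
Definition level (n : nat) (k : 'I_n) : R := k%:R - (n%:R - 1) / 2.

Definition latin_hypercube (n m : nat) (X : 'M[R]_(n, m)) : Prop :=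
  forall j : 'I_m, exists s : 'S_n, forall i : 'I_n, X i j = level (s i).

Definition pm1_mx (n m : nat) (X : 'M[R]_(n, m)) : Prop :=
  forall i j, X i j = 1 \/ X i j = -1.

Definition coldot (n m : nat) (X : 'M[R]_(n, m)) (i j : 'I_m) : R :=
  ((col i X)^T *m col j X) 0 0.

Definition orthogonal_mx (n m : nat) (X : 'M[R]_(n, m)) : Prop :=
  forall i j : 'I_m, i != j -> coldot X i j = 0.

Definition rho (n m : nat) (X : 'M[R]_(n, m)) (i j : 'I_m) : R :=
  coldot X i j / Num.sqrt (coldot X i i * coldot X j j).

(* The values maximized are nonnegative, so the default 0 matters only when
   m <= 1; it is then the conventional value. *)
Definition rhoM (n m : nat) (X : 'M[R]_(n, m)) : R :=
  \big[Num.max/0]_(i < m) \big[Num.max/0]_(j < m | (i < j)%N) `|rho X i j|.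

(* For m <= 1 the sum is empty, so this is the conventional value 0. *)
Definition rho2 (n m : nat) (X : 'M[R]_(n, m)) : R :=
  (\sum_(i < m) \sum_(j < m | (i < j)%N) rho X i j ^+ 2)
  / (m%:R * (m%:R - 1) / 2).

End Designs.

(* Main.v *)
(* Since L^T L = (A^T A) (x) (B^T B) + n2^2 (C^T C) (x) (D^T D), the cross terms
   being killed by A^T C = 0 or B^T D = 0, and A^T A = n1 I, D^T D = n2 I, two
   distinct columns of L are correlated only if they share their first index
   (correlation w3 rho(B)) or their second one (correlation w4 rho(C)).
   L is a Latin hypercube because A p i * B q j and C p i * D q j are levels
   whose indices are the digits, in mixed radix (n1, n2), of the index of the
   level in L; these digits determine (p, q) by condition (a) or (b). *)

Require Import Defs.
From mathcomp Require Import all_boot all_order all_algebra all_fingroup.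
From mathcomp Require Import ring lra.

Set Implicit Arguments.
Unset Strict Implicit.
Unset Printing Implicit Defensive.

Import Order.TTheory GRing.Theory Num.Theory.
Local Open Scope ring_scope.

(** * Sums over tensor-product indices and over off-diagonal pairs *)

Section PairIndices.

Variable V : nmodType.

Lemma big_mxtens_index (m n : nat) (F : 'I_(m * n) -> V) :
  \sum_u F u = \sum_i \sum_j F (mxtens_index (i, j)).
Proof.
rewrite pair_bigA /= (reindex (@mxtens_index m n)) /=; last first.
  by apply: onW_bij; exists (@mxtens_unindex m n);
    [exact: mxtens_indexK | exact: mxtens_unindexK].
by apply: eq_bigr => -[].
Qed.

Lemma mxtens_index_eq (m n : nat) (i i' : 'I_m) (j j' : 'I_n) :
  (mxtens_index (i, j) == mxtens_index (i', j')) = (i == i') && (j == j').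
Proof. by rewrite (can_eq (@mxtens_indexK m n)) xpair_eqE. Qed.

Lemma sum_offdiag_sym (m : nat) (F : 'I_m -> 'I_m -> V) :
  (forall i j, F i j = F j i) ->
  \sum_i \sum_(j | j != i) F i j =
    (\sum_(i < m) \sum_(j < m | (i < j)%N) F i j) *+ 2.
Proof.
move=> Fsym.
have -> : \sum_i \sum_(j | j != i) F i j =
    \sum_(i < m) \sum_(j < m | (i < j)%N) F i j +
    \sum_(i < m) \sum_(j < m | (j < i)%N) F i j.
  rewrite -big_split; apply: eq_bigr => i _ /=.
  rewrite (bigID (fun j : 'I_m => (i < j)%N)) /=.
  by congr (_ + _); apply: eq_bigl => j; rewrite -val_eqE /=; case: ltngtP.
rewrite mulr2n; congr (_ + _).
rewrite (exchange_big_dep predT) //=.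
by apply: eq_bigr => i _; apply: eq_bigr => j _; exact: Fsym.
Qed.

End PairIndices.

(** * Levels, Latin hypercubes and their correlations *)

Section Levels.

Variable R : rcfType.

Lemma level_inj n : injective (@level R n).
Proof.
move=> k l /addIr /eqP; rewrite eqr_nat => /eqP; exact: val_inj.
Qed.

Lemma level_rev n (k : 'I_n) : level R (rev_ord k) = - level R k.
Proof.
rewrite /level /= natrB // -[k.+1]addn1 natrD; lra.
Qed.

Lemma mul_sign_level n (e : R) (k : 'I_n) :
  e = 1 \/ e = -1 -> exists l : 'I_n, e * level R k = level R l.
Proof.
case=> ->; first by exists k; rewrite mul1r.
by exists (rev_ord k); rewrite mulN1r level_rev.
Qed.

(** The index is [l * n2 + k], and the centring offsets add up: [(n2 - 1) / 2 + n2 * (n1 - 1) / 2 =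
    (n1 * n2 - 1) / 2]. This is what the choice [gamma = n2] achieves. *)
Lemma level_mxtens_index n1 n2 (l : 'I_n1) (k : 'I_n2) :
  level R (mxtens_index (l, k)) = level R k + n2%:R * level R l.
Proof. rewrite /level /= natrD !natrM; lra. Qed.

Lemma sum_level_sqr n :
  \sum_(k < n) level R k ^+ 2 = n%:R * (n%:R ^+ 2 - 1) / 12.
Proof.
(* The centre [(n - 1) / 2] moves with [n], so the induction is done with a fixed arbitrary centre
   [c]. *)
have shifted c : \sum_(k < n) (k%:R - c) ^+ 2 =
    n%:R * (n%:R - 1) * (2 * n%:R - 1) / 6
    - c * n%:R * (n%:R - 1) + n%:R * c ^+ 2 :> R.
  elim: n => [|n IHn]; first by rewrite big_ord0; lra.
  by rewrite big_ord_recr /= IHn -[n.+1]addn1 natrD; field.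
by rewrite shifted; field.
Qed.

(** An injective self-map of the finite type ['I_n] is a permutation. *)
Lemma latin_hypercube_inj n m (X : 'M[R]_(n, m)) :
  (forall i j, exists k : 'I_n, X i j = level R k) ->
  (forall j, injective (X ^~ j)) -> latin_hypercube X.
Proof.
move=> Xlevel Xinj j.
have [f Xf] := fin_all_exists (Xlevel ^~ j).
have f_inj : injective f by move=> i i' eqf; apply: (Xinj j); rewrite !Xf eqf.
by exists (perm f_inj) => i; rewrite permE.
Qed.

Lemma latin_hypercube_level n m (X : 'M[R]_(n, m)) i j :
  latin_hypercube X -> exists k : 'I_n, X i j = level R k.
Proof. by case/(_ j) => s Xs; exists (s i). Qed.

Lemma latin_hypercube_col_inj n m (X : 'M[R]_(n, m)) j :
  latin_hypercube X -> injective (X ^~ j).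
Proof.
by case/(_ j) => s Xs i i'; rewrite !Xs => /level_inj; exact: perm_inj.
Qed.

Lemma coldotE n m (X : 'M[R]_(n, m)) i j : coldot X i j = (X^T *m X) i j.
Proof. by rewrite /coldot !mxE; apply: eq_bigr => k _; rewrite !mxE. Qed.

Lemma coldotC n m (X : 'M[R]_(n, m)) i j : coldot X i j = coldot X j i.
Proof. by rewrite !coldotE !mxE; apply: eq_bigr => k _; rewrite !mxE mulrC. Qed.

Lemma coldot_latin n m (X : 'M[R]_(n, m)) j :
  latin_hypercube X -> coldot X j j = n%:R * (n%:R ^+ 2 - 1) / 12.
Proof.
case/(_ j) => s Xs; rewrite coldotE mxE -sum_level_sqr [RHS](reindex_perm s).
by apply: eq_bigr => i _; rewrite mxE Xs expr2.
Qed.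

Lemma coldot_pm1 n m (X : 'M[R]_(n, m)) j :
  pm1_mx X -> coldot X j j = n%:R.
Proof.
move=> Xpm1; rewrite coldotE mxE (eq_bigr (fun=> 1)).
  by rewrite sumr_const card_ord.
by move=> i _; rewrite mxE; case: (Xpm1 i j) => ->; ring.
Qed.

Lemma latin_norm_ge0 n : 0 <= n%:R * (n%:R ^+ 2 - 1) / 12 :> R.
Proof.
by rewrite -sum_level_sqr sumr_ge0 // => k _; exact: sqr_ge0.
Qed.

Lemma rho_latin n m (X : 'M[R]_(n, m)) i j : latin_hypercube X ->
  rho X i j = coldot X i j / (n%:R * (n%:R ^+ 2 - 1) / 12).
Proof.
by move=> LX; rewrite /rho !coldot_latin // -expr2 sqrtr_sqr ger0_norm
  ?latin_norm_ge0.
Qed.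

Lemma rhoC n m (X : 'M[R]_(n, m)) i j : rho X i j = rho X j i.
Proof. by rewrite /rho coldotC [_ * coldot X j j]mulrC. Qed.

(** Ordered pairs [j != i] split along tensor indices more easily than pairs [i < j]; by symmetry
    the factor 2 cancels. *)
Lemma rho2E n m (X : 'M[R]_(n, m)) :
  rho2 X = (\sum_i \sum_(j | j != i) rho X i j ^+ 2) / (m%:R * (m%:R - 1)).
Proof.
rewrite (sum_offdiag_sym (F := fun i j => rho X i j ^+ 2)) /rho2; last first.
  by move=> i j; rewrite rhoC.
by rewrite invfM invrK; ring.
Qed.

(** Without the division this holds even for [m <= 1], where both sides vanish, so one-column [B] or
    [C] needs no separate case later. *)
Lemma sum_rho_sqr n m (X : 'M[R]_(n, m)) :
  \sum_i \sum_(j | j != i) rho X i j ^+ 2 = m%:R * (m%:R - 1) * rho2 X.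
Proof.
have := rho2E X; case: m X => [|[|m]] X.
- by rewrite big_ord0 !mul0r.
- move=> _; rewrite subrr mulr0 mul0r big_ord1 big_pred0 // => j.
  by rewrite (ord1 j) eqxx.
move=> ->; rewrite mulrC divfK // mulf_neq0 ?pnatr_eq0 //.
by rewrite subr_eq0 pnatr_eq1.
Qed.

Lemma rhoM_ge0 n m (X : 'M[R]_(n, m)) : 0 <= rhoM X.
Proof. exact: bigmax_ge_id. Qed.

Lemma rho_le_rhoM n m (X : 'M[R]_(n, m)) i j :
  i != j -> `|rho X i j| <= rhoM X.
Proof.
wlog lt_ij : i j / (i < j)%N => [th|_].
  rewrite -val_eqE neq_ltn => /orP[] lt_ij; last rewrite rhoC.
    by apply: th => //; rewrite -val_eqE ltn_eqF.
  by apply: th => //; rewrite -val_eqE ltn_eqF.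
apply: le_trans (le_bigmax _ _ i).
exact: (le_bigmax_cond 0 (fun j => `|rho X i j|)).
Qed.

Lemma rhoM_le n m (X : 'M[R]_(n, m)) c : 0 <= c ->
  (forall i j, i != j -> `|rho X i j| <= c) -> rhoM X <= c.
Proof.
move=> c0 le_c; apply: bigmax_le => // i _; apply: bigmax_le => // j lt_ij.
by apply: le_c; rewrite -val_eqE ltn_eqF.
Qed.

Lemma pm1_mul_eq (e e' x x' : R) : e = 1 \/ e = -1 -> e' = 1 \/ e' = -1 ->
  e * x = e' * x' -> x = x' \/ x = - x'.
Proof. by case=> -> [] -> ?; [left|right|right|left]; lra. Qed.

Lemma pm1_mulI (e x x' : R) : e = 1 \/ e = -1 -> e * x = e * x' -> x = x'.
Proof. by case=> -> ?; lra. Qed.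

End Levels.

(** * The tensor design: Latin property and Gram matrix *)

Section Construction.

Variables (R : rcfType) (n1 n2 m1 m2 : nat).
Variables (A : 'M[R]_(n1, m1)) (B : 'M[R]_(n2, m2)).
Variables (C : 'M[R]_(n1, m1)) (D : 'M[R]_(n2, m2)).
Hypotheses (hA : pm1_mx A) (hB : latin_hypercube B).
Hypotheses (hC : latin_hypercube C) (hD : pm1_mx D).

Let L := A *t B + n2%:R *: (C *t D).

Lemma tensor_design_latin :
  (forall i p p', C p i = - C p' i -> A p i = A p' i) \/
  (forall j q q', B q j = - B q' j -> D q j = D q' j) ->
  latin_hypercube L.
Proof.
move=> hab.
(* The signs are grouped so that each summand is a sign times a level, hence again a level by
   symmetry of the levels. *)
have LE p q i j : L (mxtens_index (p, q)) (mxtens_index (i, j)) =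
    A p i * B q j + n2%:R * (D q j * C p i).
  by rewrite mxE tensmxE mxE tensmxE [C p i * _]mulrC.
have ABlevel p q i j : exists k : 'I_n2, A p i * B q j = level R k.
  by have [k ->] := latin_hypercube_level q j hB; apply: mul_sign_level.
have DClevel p q i j : exists l : 'I_n1, D q j * C p i = level R l.
  by have [k ->] := latin_hypercube_level p i hC; apply: mul_sign_level.
apply: latin_hypercube_inj.
  move=> u v; case: (mxtens_indexP u) => p q; case: (mxtens_indexP v) => i j.
  have [k ABk] := ABlevel p q i j; have [l DCl] := DClevel p q i j.
  by exists (mxtens_index (l, k)); rewrite LE ABk DCl level_mxtens_index.
move=> v u u'; case: (mxtens_indexP v) => i j.
case: (mxtens_indexP u) => p q; case: (mxtens_indexP u') => p' q'.
rewrite !LE.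
have [k ABk] := ABlevel p q i j; have [l DCl] := DClevel p q i j.
have [k' ABk'] := ABlevel p' q' i j; have [l' DCl'] := DClevel p' q' i j.
rewrite ABk ABk' DCl DCl' -!level_mxtens_index => /level_inj.
move=> /(can_inj (@mxtens_indexK _ _)) [eq_l eq_k].
have eqAB : A p i * B q j = A p' i * B q' j by rewrite ABk ABk' eq_k.
have eqDC : D q j * C p i = D q' j * C p' i by rewrite DCl DCl' eq_l.
have injB := latin_hypercube_col_inj hB; have injC := latin_hypercube_col_inj hC.
(* Once the signs in [A] agree, [eqAB] gives [q = q']; then the signs in [D] agree and [eqDC] gives
   [p = p']. *)
have eq_pq : A p i = A p' i -> mxtens_index (p, q) = mxtens_index (p', q').
  move=> eqA; move: eqAB; rewrite eqA => /(pm1_mulI (hA p' i))/injB eq_q.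
  by move: eqDC; rewrite eq_q => /(pm1_mulI (hD q' j))/injC ->.
have eq_qp : D q j = D q' j -> mxtens_index (p, q) = mxtens_index (p', q').
  move=> eqD; move: eqDC; rewrite eqD => /(pm1_mulI (hD q' j))/injC eq_p.
  by apply: eq_pq; rewrite eq_p.
(* By [eqDC], the entries of [C] are equal, so [p = p'], or opposite, so (a) applies; either way the
   signs in [A] agree. Case (b) is dual. *)
case: hab => [ha | hb].
  by case: (pm1_mul_eq (hD q j) (hD q' j) eqDC) => [/injC eq_p | /ha //];
    apply: eq_pq; rewrite eq_p.
by case: (pm1_mul_eq (hA p i) (hA p' i) eqAB) => [/injB eq_q | /hb //];
  apply: eq_qp; rewrite eq_q.
Qed.

Hypotheses (hAo : orthogonal_mx A) (hDo : orthogonal_mx D).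
Hypothesis hACBD : A^T *m C = 0 \/ B^T *m D = 0.

(** The factor [n1] is the squared norm of a column of [A]; [n2 ^ 3] combines [gamma ^ 2] with the
    squared norm [n2] of a column of [D]. *)
Lemma coldot_tensor_design i k j l :
  coldot L (mxtens_index (i, k)) (mxtens_index (j, l)) =
    (i == j)%:R * (n1%:R * coldot B k l)
    + (k == l)%:R * (n2%:R ^+ 3 * coldot C i j).
Proof.
have cross : (A^T *m C) *t (B^T *m D) = 0.
  by case: hACBD => ->; rewrite (tens0mx, tensmx0).
have LL : L^T *m L =
    (A^T *m A) *t (B^T *m B) + n2%:R ^+ 2 *: ((C^T *m C) *t (D^T *m D)).
  have -> : L^T = A^T *t B^T + n2%:R *: (C^T *t D^T).
    by apply/matrixP => u v; rewrite !mxE.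
  rewrite /L mulmxDl !mulmxDr.
  rewrite -!scalemxAl -!scalemxAr !tensmx_mul cross.
  (* The second cross term is the transpose of the first. *)
  have -> : (C^T *m A) *t (D^T *m B) = 0.
    by rewrite -[LHS]trmxK trmx_tens !trmx_mul !trmxK cross trmx0.
  by rewrite !scaler0 addr0 add0r scalerA expr2.
have dotA : (A^T *m A) i j = (i == j)%:R * n1%:R.
  rewrite -coldotE; case: eqVneq => [-> | /hAo ->]; last by rewrite mul0r.
  by rewrite coldot_pm1 // mul1r.
have dotD : (D^T *m D) k l = (k == l)%:R * n2%:R.
  rewrite -coldotE; case: eqVneq => [-> | /hDo ->]; last by rewrite mul0r.
  by rewrite coldot_pm1 // mul1r.
rewrite coldotE LL mxE tensmxE [X in _ + X]mxE tensmxE dotA dotD -!coldotE; ring.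
Qed.

End Construction.

(** Off the diagonal the two indicators are never both 1. Row [(i, k)] thus contributes the [G k l]
    from its own block and one [H i j] from each other block; summing over rows repeats the first
    total [m1] times and the second [m2] times. *)
Lemma sum_offdiag_mxtens (R : pzRingType) (m1 m2 : nat)
    (F : 'I_(m1 * m2) -> 'I_(m1 * m2) -> R)
    (G : 'I_m2 -> 'I_m2 -> R) (H : 'I_m1 -> 'I_m1 -> R) :
  (forall i k j l, mxtens_index (i, k) != mxtens_index (j, l) ->
    F (mxtens_index (i, k)) (mxtens_index (j, l)) =
      (i == j)%:R * G k l + (k == l)%:R * H i j) ->
  \sum_u \sum_(v | v != u) F u v =
    m1%:R * (\sum_k \sum_(l | l != k) G k l)
    + m2%:R * (\sum_i \sum_(j | j != i) H i j).
Proof.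
move=> FE.
have row i k : \sum_(v | v != mxtens_index (i, k)) F (mxtens_index (i, k)) v =
    \sum_(l | l != k) G k l + \sum_(j | j != i) H i j.
  rewrite big_mkcond big_mxtens_index (bigD1 i) //=; congr (_ + _).
    rewrite [RHS]big_mkcond; apply: eq_bigr => l _.
    rewrite mxtens_index_eq eqxx /=; case: ifPn => // lk.
    rewrite FE ?mxtens_index_eq ?eqxx ?[k == l]eq_sym //=.
    by rewrite (negPf lk) mul1r mul0r addr0.
  apply: eq_bigr => j ji; rewrite (bigD1 k) //= big1 ?addr0 => [|l lk].
    rewrite mxtens_index_eq (negPf ji) /= FE ?mxtens_index_eq [i == j]eq_sym.
      by rewrite (negPf ji) eqxx mul0r mul1r add0r.
    by rewrite (negPf ji).
  rewrite mxtens_index_eq (negPf ji) /= FE ?mxtens_index_eq [i == j]eq_sym.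
    by rewrite (negPf ji) [k == l]eq_sym (negPf lk) !mul0r addr0.
  by rewrite (negPf ji).
rewrite big_mxtens_index.
under eq_bigr => i _ do under eq_bigr => k _ do rewrite row.
under eq_bigr => i _ do rewrite big_split /= sumr_const card_ord.
by rewrite big_split /= sumr_const card_ord sumrMnl !mulr_natl.
Qed.

Theorem proposition4 (R : rcfType) (n1 n2 m1 m2 : nat)
    (hn1 : (2 <= n1)%N) (hn2 : (2 <= n2)%N) (hm : (2 <= m1 * m2)%N)
    (A : 'M[R]_(n1, m1)) (B : 'M[R]_(n2, m2))
    (C : 'M[R]_(n1, m1)) (D : 'M[R]_(n2, m2))
    (hA : pm1_mx A) (hB : latin_hypercube B)
    (hC : latin_hypercube C) (hD : pm1_mx D)
    (hab : (forall (i : 'I_m1) (p p' : 'I_n1),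
              C p i = - C p' i -> A p i = A p' i) \/
           (forall (j : 'I_m2) (q q' : 'I_n2),
              B q j = - B q' j -> D q j = D q' j))
    (hAo : orthogonal_mx A) (hDo : orthogonal_mx D)
    (hACBD : A^T *m C = 0 \/ B^T *m D = 0) :
  let gamma : R := n2%:R in
  let L := A *t B + gamma *: (C *t D) in
  let n : R := (n1 * n2)%:R in
  let w1 := (m2%:R - 1) * (n2%:R ^+ 2 - 1) ^+ 2 /
            (((m1 * m2)%:R - 1) * (n ^+ 2 - 1) ^+ 2) in
  let w2 := n2%:R ^+ 4 * (m1%:R - 1) * (n1%:R ^+ 2 - 1) ^+ 2 /
            (((m1 * m2)%:R - 1) * (n ^+ 2 - 1) ^+ 2) in
  let w3 := (n2%:R ^+ 2 - 1) / (n ^+ 2 - 1) in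
  let w4 := n2%:R ^+ 2 * (n1%:R ^+ 2 - 1) / (n ^+ 2 - 1) in
  [/\ latin_hypercube L,
      rho2 L = w1 * rho2 B + w2 * rho2 C &
      rhoM L = Num.max (w3 * rhoM B) (w4 * rhoM C)].
Proof.
move=> gamma L n w1 w2 w3 w4.
have LL : latin_hypercube L by exact: tensor_design_latin.
have [m1_gt0 m2_gt0] : (0 < m1)%N /\ (0 < m2)%N.
  by apply/andP; rewrite -muln_gt0; exact: ltnW.
have n1_ge2 : 2 <= n1%:R :> R by rewrite ler_nat.
have n2_ge2 : 2 <= n2%:R :> R by rewrite ler_nat.
have nE : n = n1%:R * n2%:R by rewrite /n natrM.
have n_ge4 : 4 <= n by rewrite nE; nra.
have sqr_gt1 (x : R) : 2 <= x -> 0 < x ^+ 2 - 1 by move=> ?; nra.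
have n_sqr_gt1 : 0 < n ^+ 2 - 1 by nra.
have w3_gt0 : 0 < w3 by rewrite divr_gt0 // sqr_gt1.
have w4_gt0 : 0 < w4 by rewrite divr_gt0 // mulr_gt0 ?sqr_gt1 //; nra.
have nz1 : n1%:R ^+ 2 - 1 != 0 :> R by rewrite gt_eqF ?sqr_gt1.
have nz2 : n2%:R ^+ 2 - 1 != 0 :> R by rewrite gt_eqF ?sqr_gt1.
have nz : (n1%:R * n2%:R) ^+ 2 - 1 != 0 :> R by rewrite -nE gt_eqF.
have z1 : n1%:R != 0 :> R by rewrite gt_eqF //; lra.
have z2 : n2%:R != 0 :> R by rewrite gt_eqF //; lra.
have rhoL i k j l : rho L (mxtens_index (i, k)) (mxtens_index (j, l)) =
    (i == j)%:R * (w3 * rho B k l) + (k == l)%:R * (w4 * rho C i j).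
  (* [w3] and [w4] arise as the ratios of squared column norms of [B] and [C], scaled by [n1] and
     [n2 ^ 3], to those of [L]. *)
  rewrite !rho_latin // coldot_tensor_design // /w3 /w4 nE natrM.
  by field; rewrite nz nz1 nz2 z1 z2.
split=> //.
  rewrite [LHS]rho2E.
  rewrite (sum_offdiag_mxtens (G := fun k l => w3 ^+ 2 * rho B k l ^+ 2)
     (H := fun i j => w4 ^+ 2 * rho C i j ^+ 2)); last first.
    move=> i k j l; rewrite rhoL mxtens_index_eq.
    (* The cross term of the square vanishes because [i = j] and [k = l] cannot both hold. *)
    by case: (i == j); case: (k == l) => //= _; ring.
  under eq_bigr => k _ do rewrite -mulr_sumr.
  under [in X in _ + X]eq_bigr => i _ do rewrite -mulr_sumr.
  (* Here [w1 = (m2 - 1) / (m1 * m2 - 1) * w3 ^ 2], and likewise [w2] with [m1 - 1] and [w4]. *)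
  rewrite -!mulr_sumr !sum_rho_sqr /w1 /w2 /w3 /w4 nE natrM.
  have zm1 : m1%:R != 0 :> R by rewrite pnatr_eq0 -lt0n.
  have zm2 : m2%:R != 0 :> R by rewrite pnatr_eq0 -lt0n.
  have zm : m1%:R * m2%:R - 1 != 0 :> R.
    by rewrite -natrM subr_eq0 pnatr_eq1 gtn_eqF.
  by field; rewrite zm1 zm2 zm nz.
apply/le_anti/andP; split.
  apply: rhoM_le.
    by rewrite le_max mulr_ge0 ?rhoM_ge0 // ltW.
  move=> u v; case: (mxtens_indexP u) => i k; case: (mxtens_indexP v) => j l.
  rewrite mxtens_index_eq rhoL le_max.
  have [<-|ij] /= := eqVneq i j => kl.
    rewrite (negPf kl) mul1r mul0r addr0 normrM gtr0_norm //.
    by rewrite ler_pM2l // rho_le_rhoM.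
  have [_|_] := eqVneq k l.
    rewrite mul1r mul0r add0r normrM gtr0_norm //.
    by rewrite [X in _ || X]ler_pM2l // rho_le_rhoM // orbT.
  (* Columns sharing neither index are uncorrelated; nonnegativity of the bound suffices. *)
  by rewrite !mul0r addr0 normr0 mulr_ge0 ?rhoM_ge0 // ltW.
rewrite ge_max; apply/andP; split.
  rewrite mulrC -ler_pdivlMr //; apply: rhoM_le => [|k l kl].
    by rewrite divr_ge0 ?rhoM_ge0 // ltW.
  (* Any fixed first index works: columns [(i, k)] and [(i, l)] of [L] realise [w3 * rho B k l]. *)
  pose i := Ordinal m1_gt0.
  rewrite ler_pdivlMr // mulrC -[w3]gtr0_norm // -normrM.
  have -> : w3 * rho B k l = rho L (mxtens_index (i, k)) (mxtens_index (i, l)).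
    by rewrite rhoL eqxx (negPf kl) mul1r mul0r addr0.
  by rewrite rho_le_rhoM // mxtens_index_eq eqxx.
rewrite mulrC -ler_pdivlMr //; apply: rhoM_le => [|i j ij].
  by rewrite divr_ge0 ?rhoM_ge0 // ltW.
pose k := Ordinal m2_gt0.
rewrite ler_pdivlMr // mulrC -[w4]gtr0_norm // -normrM.
have -> : w4 * rho C i j = rho L (mxtens_index (i, k)) (mxtens_index (j, k)).
  by rewrite rhoL eqxx (negPf ij) mul1r mul0r add0r.
by rewrite rho_le_rhoM // mxtens_index_eq (negPf ij).
Qed.
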